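(* Let $n,m\in\mathbb N$ and let $f:\mathbb R\to\mathbb T\mathbb P^m$ be a non-constant $n$-th tropical holomorphic curve with a reduced representation $\mathbf f=(f_0,\dots,f_m)$. Let $P$ be a tropical homogeneous polynomial of degree $d>0$ of the form $$P(x)=\left(\bigoplus_{k=0}^{m}\alpha_k\otimes x_k^{\otimes d}\right)\oplus\left(\bigoplus_{\sum_{k=0}^m i_k=d,\ i_k<d}\alpha_{i_0,\dots,i_m}\otimes\bigotimes_{k=0}^m x_k^{\otimes i_k}\right),$$ where $\alpha_k\in\mathbb R$ for $k=0,\dots,m$ and $\alpha_{i_0,\dots,i_m}\in\mathbb R_{\max}$ for $\sum_{k=0}^m i_k=d$, $i_k<d$. Then $$T_f(r)=\frac1d\left(\sum_{j=1}^nN^{(j)}\left(r,1_0\oslash (P\circ f)\right)-\sum_{j=1}^nN^{(j)}\left(r,P\circ f\right)\right)+O(1).$$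
   Context: $\mathbb N=\{1,2,\dots\}$. Tropical operations: $\mathbb R_{\max}=\mathbb R\cup\{-\infty\}$, $a\oplus b=\max\{a,b\}$, $a\otimes b=a+b$, $a\oslash b=a-b$, $a^{\otimes k}=ka$, $0_0=-\infty$, $1_0=0$; thus $1_0\oslash g=-g$. Exponents $i_k$ are non-negative integers. For $n\in\mathbb N$, an $n$-th tropical meromorphic function is a continuous function $g:\mathbb R\to\mathbb R$ for which there is an increasing sequence of breakpoints without finite accumulation point such that $g$ is a polynomial on each segment, the supremum of the degrees being $n$; a $0$-th one is a constant. Sign convention: $\operatorname{sgn}(x^{\pm})=\operatorname{sgn}(x)$ for $x\ne0$ and $\operatorname{sgn}(0^{\pm})=\pm1$. $\omega_g^{(j)}(x)=\frac1{j!}\left(\operatorname{sgn}^{j+1}(x^+)g^{(j)}(x^+)-\operatorname{sgn}^{j+1}(x^-)g^{(j)}(x^-)\right)$, with one-sided derivatives. $x$ is a $j$-th root (pole) of $g$ if $\omega_g^{(j)}(x)>0$ ($<0$), with multiplicity $|\omega_g^{(j)}(x)|$. $g$ is tropical entire if it has no $j$-th poles for any $j$. For a continuous function $g:\mathbb R\to\mathbb R$ that is a polynomial on each segment between consecutive points of some increasing sequence of breakpoints without finite accumulation point, the degrees of the polynomial pieces being bounded, $N^{(j)}(r,g)=\frac12\sum_z|\omega_g^{(j)}(z)|(r-|z|)^j$, over all $j$-th poles $z$ of $g$ in $(-r,r)$. $\mathbb T\mathbb P^m$ is the quotient of $\mathbb R_{\max}^{m+1}\setminus\{(-\infty,\dots,-\infty)\}$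 by $(a_0,\dots,a_m)\sim(a_0+\lambda,\dots,a_m+\lambda)$, $\lambda\in\mathbb R$; classes are written $[a_0:\cdots:a_m]$. An $n$-th tropical holomorphic curve is a map $f=[f_0:\cdots:f_m]:\mathbb R\to\mathbb T\mathbb P^m$ where $f_i$ is an $n_i$-th tropical entire function, $n_i\in\mathbb N\cup\{0\}$, $\max_i n_i=n$. The tuple $\mathbf f=(f_0,\dots,f_m)$ is a reduced representation if, for every $j$, no point is a $j$-th root common to all of $f_0,\dots,f_m$. The tropical Cartan characteristic function is $T_f(r)=\frac12(F(r)+F(-r))-F(0)$ with $F=\max_{0\le i\le m}f_i$ (for a reduced representation). $P\circ f$ denotes $P(f_0,\dots,f_m)$, i.e. $x\mapsto\max_{i_0+\cdots+i_m=d}\{\alpha_{i_0,\dots,i_m}+\sum_k i_kf_k(x)\}$, the coefficient of the monomial $x_k^{\otimes d}$ being $\alpha_k$. *)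

(* Defs.v *)
From HB Require Import structures.
From mathcomp Require Import all_boot all_order all_algebra.
From mathcomp Require Import generic_quotient.
From mathcomp Require Import all_classical all_reals all_analysis.
Set Implicit Arguments.
Unset Strict Implicit.
Unset Printing Implicit Defensive.
Import Order.TTheory GRing.Theory Num.Theory.
Import numFieldNormedType.Exports.
Local Open Scope classical_set_scope.
Local Open Scope ring_scope.

Definition sgn_right (R : realType) (x : R) : R := if x == 0 then 1 else Num.sg x.
Definition sgn_left (R : realType) (x : R) : R := if x == 0 then -1 else Num.sg x.

(* One-sided j-th derivatives g^(j)(x^+) and g^(j)(x^-), as one-sided limits of
   the j-th derivative. *)
Definition deriv_right (R : realType) (g : R -> R) (j : nat) (x : R) : R :=
  lim (derive1n j g y @[y --> x^'+]).
Definition deriv_left (R : realType) (g : R -> R) (j : nat) (x : R) : R :=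
  lim (derive1n j g y @[y --> x^'-]).

Definition omega (R : realType) (g : R -> R) (j : nat) (x : R) : R :=
  (j`!%:R)^-1 * (sgn_right x ^+ j.+1 * deriv_right g j x
                 - sgn_left x ^+ j.+1 * deriv_left g j x).

Definition trop_root (R : realType) (g : R -> R) (j : nat) (x : R) : Prop :=
  0 < omega g j x.
Definition trop_pole (R : realType) (g : R -> R) (j : nat) (x : R) : Prop :=
  omega g j x < 0.

(* A strictly increasing two-sided sequence without finite accumulation point is
   unbounded in both directions, so its segments cover the line. A finite or
   one-sided sequence of breakpoints is completed by points where g does not
   change polynomial. The polynomial p k has degree (size (p k)).-1. *)
Definition trop_meromorphic (R : realType) (n : nat) (g : R -> R) : Prop :=
  if n is 0 then exists c : R, forall x : R, g x = c else
  continuous g /\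
  exists (b : int -> R) (p : int -> {poly R}),
    [/\ {homo b : k l / k < l},
        limit_point (range b) = set0,
        forall (k : int) (x : R), b k <= x <= b (k + 1) -> g x = (p k).[x],
        forall k : int, ((size (p k)).-1 <= n)%N &
        exists k : int, (size (p k)).-1 = n].

Definition trop_entire (R : realType) (n : nat) (g : R -> R) : Prop :=
  trop_meromorphic n g /\
  forall (j : nat) (x : R), (0 < j)%N -> ~ trop_pole g j x.

Definition counting_N (R : realType) (j : nat) (r : R) (g : R -> R) : R :=
  2^-1 * \sum_(z \in [set z : R | - r < z < r /\ trop_pole g j z])
           `|omega g j z| * (r - `|z|) ^+ j.

(* R_max is represented by the elements of \bar R other than +oo. There, tropical
   sum, product and k-th power are maxe, adde and *+ k, and the zero is -oo. *)
Definition in_Rmax (R : realType) (a : \bar R) : bool := a != +oo%E.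

Definition hom_coord (R : realType) (m : nat) (a : {ffun 'I_m.+1 -> \bar R}) : bool :=
  [forall i, in_Rmax (a i)] && [exists i, a i != -oo%E].

Notation hom_coords R m := {a : {ffun 'I_m.+1 -> \bar R} | hom_coord a}.

Definition hom_equiv (R : realType) (m : nat) (a b : hom_coords R m) : bool :=
  `[< exists lambda : R, forall i, (val b i = val a i + lambda%:E)%E >].

Lemma hom_equiv_refl (R : realType) (m : nat) : reflexive (@hom_equiv R m).
Proof. by move=> a; apply/asboolP; exists 0 => i; rewrite adde0. Qed.

Lemma hom_equiv_sym (R : realType) (m : nat) : symmetric (@hom_equiv R m).
Proof.
move=> a b; apply/asboolP/asboolP => -[l h]; exists (- l) => i;
  by rewrite h -addeA -EFinD subrr adde0.
Qed.

Lemma hom_equiv_trans (R : realType) (m : nat) : transitive (@hom_equiv R m).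
Proof.
move=> b a c /asboolP[l hl] /asboolP[k hk]; apply/asboolP; exists (l + k) => i.
by rewrite hk hl -addeA -EFinD.
Qed.

Canonical hom_equiv_rel (R : realType) (m : nat) :=
  EquivRel (@hom_equiv R m) (@hom_equiv_refl R m) (@hom_equiv_sym R m)
           (@hom_equiv_trans R m).

Definition trop_proj (R : realType) (m : nat) : Type :=
  {eq_quot (hom_equiv_rel R m)}%qT.

Lemma real_hom_coord (R : realType) (m : nat) (v : 'I_m.+1 -> R) :
  hom_coord [ffun i => (v i)%:E].
Proof.
by apply/andP; split; [apply/forallP => i | apply/existsP; exists ord0];
  rewrite ?/in_Rmax ffunE.
Qed.

(* The class [v_0 : ... : v_m] of a tuple of real numbers. *)
Definition trop_class (R : realType) (m : nat) (v : 'I_m.+1 -> R) : trop_proj R m :=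
  (\pi_({eq_quot (hom_equiv_rel R m)})
     (exist _ [ffun i => (v i)%:E] (real_hom_coord v)))%qT.

(* fs is the tuple of functions through which the curve f is given. *)
Definition trop_holomorphic_curve (R : realType) (n m : nat)
    (f : R -> trop_proj R m) (fs : 'I_m.+1 -> R -> R) : Prop :=
  (forall x : R, f x = trop_class (fun i => fs i x)) /\
  exists deg : 'I_m.+1 -> nat,
    (forall i, trop_entire (deg i) (fs i)) /\ (\max_(i < m.+1) deg i)%N = n.

Definition reduced_rep (R : realType) (m : nat) (fs : 'I_m.+1 -> R -> R) : Prop :=
  forall (j : nat) (x : R), (0 < j)%N -> ~ (forall i, trop_root (fs i) j x).

Definition cartan_char (R : realType) (m : nat) (fs : 'I_m.+1 -> R -> R) (r : R) : R :=
  let F x := \big[Num.max/fs ord0 x]_(i < m.+1) fs i x in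
  2^-1 * (F r + F (- r)) - F 0.

(* Multi-indices (i_0, ..., i_m) with sum d and every i_k < d. *)
Definition mixed_index (m d : nat) (i : {ffun 'I_m.+1 -> 'I_d.+1}) : bool :=
  (\sum_k i k == d)%N && [forall k, (i k < d)%N].

(* alpha gives the coefficients of the pure powers, beta the other ones. *)
Definition trop_hom_poly (R : realType) (m d : nat) (alpha : 'I_m.+1 -> R)
    (beta : {ffun 'I_m.+1 -> 'I_d.+1} -> \bar R) (x : 'I_m.+1 -> \bar R) : \bar R :=
  maxe (\big[maxe/-oo]_(k < m.+1) ((alpha k)%:E + x k *+ d))%E
       (\big[maxe/-oo]_(i | mixed_index i) (beta i + \sum_k x k *+ i k))%E.

(* The value of P at real arguments is real when the coefficients are in R_max,
   because the alpha k are real. *)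
Definition trop_comp (R : realType) (m d : nat) (alpha : 'I_m.+1 -> R)
    (beta : {ffun 'I_m.+1 -> 'I_d.+1} -> \bar R) (fs : 'I_m.+1 -> R -> R) (x : R) : R :=
  fine (trop_hom_poly alpha beta (fun k => (fs k x)%:E)).

(* Main.v *)
(* Put [G := P o f] and [F := max_i f_i]. As every pure power [x_k^d] has a
   finite coefficient and all coefficients are below [+oo], [G - d F] is bounded
   on the line, so [T_f(r)] is [1/d] times [(G(r) + G(-r))/2 - G(0)] up to
   [O(1)]. The piecewise polynomial [G] satisfies the Jensen formula, which
   equates this last quantity with the difference of the counting functions.
   To be piecewise polynomial of degree at most [n] is taken in the local form
   that there are one-sided polynomial germs at every point, a condition that is
   visibly stable under sums and maxima. *)

Require Import Defs.
From HB Require Import structures.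
From mathcomp Require Import all_boot all_order all_algebra.
From mathcomp Require Import all_classical all_reals all_analysis.
From mathcomp Require Import ring lra.
Set Implicit Arguments.
Unset Strict Implicit.
Unset Printing Implicit Defensive.
Import Order.TTheory GRing.Theory Num.Theory.
Import numFieldNormedType.Exports.
Local Open Scope classical_set_scope.
Local Open Scope ring_scope.

(** * One-sided neighbourhoods and the sign of a polynomial there *)

(** The right side is [true], the left side [false]; one proof then serves both. *)
Definition at_side (R : realType) (b : bool) (x : R) : set_system R :=
  if b then x^'+ else x^'-.

Definition side_sgn (R : realType) (b : bool) : R := if b then 1 else -1.

Lemma at_side_proper (R : realType) (b : bool) (x : R) :
  ProperFilter (at_side b x).
Proof. by case: b; rewrite /at_side; typeclasses eauto. Qed.
#[local] Existing Instance at_side_proper.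

Lemma near_at_sideP (R : realType) (b : bool) (x : R) (A : set R) :
  (\forall y \near at_side b x, A y) <->
  exists2 e : R, 0 < e & forall y, 0 < side_sgn R b * (y - x) < e -> A y.
Proof.
have E y : (0 < side_sgn R b * (y - x)) = (if b then x < y else y < x).
  by case: b; rewrite /side_sgn ?mul1r ?mulN1r ?oppr_gt0 ?subr_gt0 ?subr_lt0.
have N y : 0 < side_sgn R b * (y - x) -> side_sgn R b * (y - x) = `|x - y|.
  by case: b {E}; rewrite /side_sgn ?mul1r ?mulN1r ?opprB => h;
    rewrite ?(gtr0_norm h) // distrC gtr0_norm.
split=> [|[e e0 h]].
- case: b E N => E N /nbhs_ballP[e /= e0 h]; exists e => // y /andP[y0 ye];
    (apply: h; last by rewrite -E); rewrite /ball /= -N //.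
- case: b E N h => E N h; apply/nbhs_ballP; exists e => //= y;
    rewrite /ball /= => ye yx; apply: h; rewrite -E in yx; rewrite yx /= N //.
Qed.

(** An open punctured half-interval is a full neighbourhood of each of its points. This carries
    one-sided agreement over to derivatives and to germs at nearby points. *)
Lemma near_at_side_nbhs (R : realType) (b : bool) (x : R) (A : set R) :
  (\forall y \near at_side b x, A y) ->
  \forall y \near at_side b x, \forall z \near y, A z.
Proof.
move=> /near_at_sideP[e e0 h]; apply/near_at_sideP; exists e => // y.
set u := side_sgn R b * (y - x) => /andP[u0 ue].
have m0 : 0 < Num.min u (e - u) by rewrite lt_min u0 subr_gt0.
apply/nbhs_ballP; exists (Num.min u (e - u)) => //= z; rewrite /ball /= => hz.
apply: h; move: hz; rewrite lt_min !ltr_norml /u /side_sgn.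
by case: (b) => /andP[/andP[? ?] /andP[? ?]]; apply/andP; split; lra.
Qed.

Lemma cvg_at_side (R : realType) (b : bool) (x : R) : at_side b x --> x.
Proof.
case: b => A /nbhs_ballP[e e0 h]; apply/nbhs_ballP; exists e => // y ye _;
  exact: h.
Qed.

(** Dividing out the zero at [x] leaves a factor that does not vanish there, so [p] keeps a strict
    sign on one side. *)
Lemma near_poly_sign (R : realType) (b : bool) (x : R) (p : {poly R}) :
  p != 0 -> exists2 c : R, 0 <= c * p.[x] &
    \forall y \near at_side b x, 0 < c * p.[y].
Proof.
move=> p0; have [k [q]] := multiplicity_XsubC p x.
rewrite p0 /= => qx pE; rewrite {p0}pE.
(* [q.[x]] has the sign of [q] near [x], the other factor that of [(y - x) ^+ k] on the side [b]. *)
exists (q.[x] * side_sgn R b ^+ k).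
  rewrite hornerM horner_exp hornerXsubC subrr.
  case: k => [|k]; last by rewrite expr0n !mulr0.
  by rewrite !expr0 !mulr1 -expr2 sqr_ge0.
have qc : \forall y \near at_side b x, 0 < q.[x] * q.[y].
  have : q.[x] * q.[y] @[y --> x] --> q.[x] * q.[x].
    by apply: cvgMr; apply: continuous_horner.
  have q20 : 0 < q.[x] * q.[x] by rewrite -expr2 exprn_even_gt0.
  by move=> /(_ _ (lt_nbhsr q20)); exact: cvg_at_side.
have sc : \forall y \near at_side b x, 0 < side_sgn R b * (y - x).
  by apply/near_at_sideP; exists 1 => // y /andP[].
near=> y; rewrite hornerM horner_exp hornerXsubC mulrACA -exprMn.
by rewrite mulr_gt0 ?exprn_gt0 //; near: y.
Unshelve. all: by end_near. Qed.

Lemma near_poly_inj (R : realType) (b : bool) (x : R) (p q : {poly R}) :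
  (\forall y \near at_side b x, p.[y] = q.[y]) -> p = q.
Proof.
move=> pq; apply/eqP; rewrite -subr_eq0; apply/negPn/negP.
move=> /(near_poly_sign b x)[c _ h].
suff: \forall y \near at_side b x, False by move/filter_ex => -[].
near=> y; have : 0 < c * (p - q).[y] by near: y.
suff -> : (p - q).[y] = 0 by rewrite mulr0 ltxx.
by rewrite hornerD hornerN; apply/eqP; rewrite subr_eq0; apply/eqP; near: y.
Unshelve. all: by end_near. Qed.

(** * Piecewise polynomial functions through germs *)

(* The clause [g x = p.[x]] at both sides of [x] encodes continuity. *)
Definition poly_germ (R : realType) (n : nat) (b : bool) (x : R)
    (g : R -> R) (p : {poly R}) : Prop :=
  [/\ (size p <= n.+1)%N, g x = p.[x] &
      \forall y \near at_side b x, g y = p.[y]].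

Definition piecewise_poly (R : realType) (n : nat) (g : R -> R) : Prop :=
  forall b x, exists p, poly_germ n b x g p.

Lemma piecewise_poly_cst (R : realType) (n : nat) (c : R) :
  piecewise_poly n (fun=> c).
Proof.
move=> b x; exists c%:P; split; rewrite ?hornerC //.
  by rewrite (leq_trans (size_polyC_leq1 _)).
by apply: nearW => y; rewrite hornerC.
Qed.

Lemma piecewise_polyD (R : realType) (n : nat) (g h : R -> R) :
  piecewise_poly n g -> piecewise_poly n h ->
  piecewise_poly n (fun x => g x + h x).
Proof.
move=> gP hP b x; have [p [sp px np]] := gP b x; have [q [sq qx nq]] := hP b x.
exists (p + q); split.
- by rewrite (leq_trans (size_polyD _ _)) // geq_max sp.
- by rewrite hornerD px qx.
- near=> y; rewrite hornerD; congr (_ + _); near: y; [exact: np | exact: nq].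
Unshelve. all: by end_near. Qed.

Lemma poly_germN (R : realType) (n : nat) (b : bool) (x : R) (g : R -> R)
    (p : {poly R}) : poly_germ n b x g p -> poly_germ n b x (\- g) (- p).
Proof.
move=> [sp px np]; split; rewrite ?size_polyN // ?hornerN /= ?px //.
by near=> y; rewrite hornerN /=; congr (- _); near: y; exact: np.
Unshelve. all: by end_near. Qed.

(** The difference of two distinct germs has constant sign on one side of [x], so the maximum is one
    of them there. The weak inequality at [x] settles the value at [x]. *)
Lemma piecewise_poly_max (R : realType) (n : nat) (g h : R -> R) :
  piecewise_poly n g -> piecewise_poly n h ->
  piecewise_poly n (fun x => Num.max (g x) (h x)).
Proof.
move=> gP hP b x; have [p [sp px np]] := gP b x; have [q [sq qx nq]] := hP b x.
have [pq|pq] := eqVneq p q.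
  exists q; split=> //; first by rewrite px qx pq maxxx.
  by apply: filterS2 np nq => y -> ->; rewrite pq maxxx.
have [c cx cn] : exists2 c : R, 0 <= c * (p - q).[x] &
    \forall y \near at_side b x, 0 < c * (p - q).[y].
  by apply: near_poly_sign; rewrite subr_eq0.
have c0 : c != 0.
  have [y] : exists y, 0 < c * (p - q).[y] by exact: filter_ex cn.
  by apply: contraTneq => ->; rewrite mul0r ltxx.
have {}cn : \forall y \near at_side b x, 0 <= c * (p - q).[y].
  by apply: filterS cn => y; exact: ltW.
have hD (y : R) : (p - q).[y] = p.[y] - q.[y] by rewrite hornerD hornerN.
have [c_gt0|c_lt0] : 0 < c \/ c < 0 by case/orP: (lt_total c0); [right|left].
- exists p; split=> //.
    by rewrite px qx; apply/max_idPl;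
      rewrite -subr_ge0 -hD -(pmulr_rge0 _ c_gt0).
  apply: filterS3 np nq cn => y -> ->; rewrite hD => cy.
  by apply/max_idPl; rewrite -subr_ge0 -(pmulr_rge0 _ c_gt0).
- exists q; split=> //.
    by rewrite px qx; apply/max_idPr;
      rewrite -subr_le0 -hD -(nmulr_rge0 _ c_lt0).
  apply: filterS3 np nq cn => y -> ->; rewrite hD => cy.
  by apply/max_idPr; rewrite -subr_le0 -(nmulr_rge0 _ c_lt0).
Qed.

(** * One-sided derivatives and [omega] in terms of germs *)

Lemma near_derive1n_germ (R : realType) (b : bool) (x : R) (g : R -> R)
    (p : {poly R}) (j : nat) :
  (\forall y \near at_side b x, g y = p.[y]) ->
  \forall y \near at_side b x, derive1n j g y = p^`(j).[y].
Proof.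
move=> gp; elim: j => [|j /near_at_side_nbhs IH] //.
apply: filterS IH => y yj; rewrite derivnS derivE derive1nS !derive1E.
exact: near_eq_derive yj.
Qed.

Lemma lim_derive1n_germ (R : realType) (n : nat) (b : bool) (x : R)
    (g : R -> R) (p : {poly R}) (j : nat) :
  poly_germ n b x g p ->
  lim (derive1n j g y @[y --> at_side b x]) = p^`N(j).[x] *+ j`!.
Proof.
move=> [_ _ np]; rewrite -hornerMn -nderivn_def; apply: cvg_lim => //.
have pc : p^`(j).[y] @[y --> at_side b x] --> p^`(j).[x].
  by move=> A /continuous_horner; exact: cvg_at_side.
apply: cvg_trans pc; apply: near_eq_cvg.
by apply: filterS (near_derive1n_germ j np) => y ->.
Qed.

(** Division by [j!] turns the derivatives of the germs into Taylor coefficients. *)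
Lemma omega_germ (R : realType) (n : nat) (x : R) (g : R -> R)
    (p q : {poly R}) (j : nat) :
  poly_germ n true x g p -> poly_germ n false x g q ->
  omega g j x =
  sgn_right x ^+ j.+1 * p^`N(j).[x] - sgn_left x ^+ j.+1 * q^`N(j).[x].
Proof.
move=> gp gq; rewrite /omega /deriv_right /deriv_left.
rewrite (lim_derive1n_germ j gp) (lim_derive1n_germ j gq) 2!mulrnAr.
by rewrite -mulrnBl -[(_ - _) *+ _]mulr_natl mulKf // pnatr_eq0 -lt0n fact_gt0.
Qed.

(** * Jensen formula: germs and their jumps *)

Section Jensen.
Variables (R : realType) (n : nat) (g : R -> R) (G : bool -> R -> {poly R}).
Hypothesis gG : forall b x, poly_germ n b x g (G b x).

(** On the side [b] close to [x], [g] equals [G b x] all around [y], so uniqueness of germs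
    identifies both germs at [y]. *)
Lemma germ_loc_const (b : bool) (x : R) :
  exists2 e : R, 0 < e & forall y, 0 < side_sgn R b * (y - x) < e ->
    forall b', G b' y = G b x.
Proof.
apply/near_at_sideP; have [_ _ /near_at_side_nbhs] := gG b x.
apply: filterS => y gy b'; have [_ _ gy'] := gG b' y.
apply: (@near_poly_inj _ b' y).
by apply: filterS2 gy' (@cvg_at_side _ b' y _ gy) => z <- <-.
Qed.

(** The list may contain points without a jump, so a point can be added without deciding whether the
    germ changes there. *)
Definition jumps_sum (a b : R) (s : seq R) : Prop :=
  [/\ uniq s, forall z, z \in s -> a < z < b,
      G false b = G true a + \sum_(z <- s) (G true z - G false z) &
      forall z, a < z < b -> z \notin s -> G true z = G false z].

Lemma jumps_sum_near (a : R) : exists2 e : R, 0 < e &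
  forall t, a < t < a + e -> jumps_sum a t [::].
Proof.
have [e e0 he] := germ_loc_const true a; exists e => // t t_e.
have h z : a < z <= t -> forall b', G b' z = G true a.
  by move=> /andP[? ?] b'; apply: he; rewrite mul1r; apply/andP; split; lra.
split=> //; first by rewrite big_nil addr0 h //; apply/andP; split; lra.
by move=> z /andP[az zt] _; rewrite !h // az ltW.
Qed.

Lemma jumps_sum_left (a b : R) : a < b -> exists2 e : R, 0 < e &
  forall t s, a < t -> b - e < t < b -> jumps_sum a t s -> jumps_sum a b s.
Proof.
move=> ab; have [e e0 he] := germ_loc_const false b; exists e => // t s a_t t_e.
have h z : t <= z < b -> forall b', G b' z = G false b.
  by move=> /andP[? ?] b'; apply: he; rewrite mulN1r; apply/andP; split; lra.
move=> [us sb st sn]; split=> //.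
- by move=> z /sb; lra.
- by rewrite -st h //; lra.
- move=> z /andP[az zb] zs; have [zt|tz] := ltP z t.
    by apply: sn => //; rewrite az.
  by rewrite !h // tz.
Qed.

Lemma jumps_sum_right (a b : R) (s : seq R) : a < b -> jumps_sum a b s ->
  exists2 e : R, 0 < e & forall t, b < t < b + e -> jumps_sum a t (b :: s).
Proof.
move=> ab [us sb st sn]; have [e e0 he] := germ_loc_const true b.
exists e => // t t_e.
have h z : b < z <= t -> forall b', G b' z = G true b.
  by move=> /andP[? ?] b'; apply: he; rewrite mul1r; apply/andP; split; lra.
split.
- by rewrite /= us andbT; apply/negP => /sb; rewrite ltxx andbF.
- move=> z; rewrite in_cons => /orP[/eqP ->|/sb]; lra.
- rewrite big_cons addrCA -st subrK h //; lra.
- move=> z /andP[az zt]; rewrite in_cons negb_or => /andP[zb zs].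
  have [zb'|bz] := ltP z b; first by apply: sn => //; rewrite az.
  by rewrite !h // lt_neqAle eq_sym zb bz ltW.
Qed.

(** Continuous induction along the interval: the supremum of the reachable points is reachable from
    the left, and if it were below [b] one could go beyond it. *)
Lemma exists_jumps_sum (a b : R) : a < b -> exists s, jumps_sum a b s.
Proof.
move=> ab; pose E := [set t | a < t <= b /\ exists s, jumps_sum a t s].
have bE : ubound E b by move=> t [/andP[]].
have [e0 e00 h0] := jumps_sum_near a.
have [t0 E0] : E !=set0.
  (* Halving [e0] keeps [a + m] strictly inside the range of [h0]. *)
  pose m := Num.min (b - a) (e0 / 2).
  have m0 : 0 < m by rewrite lt_min subr_gt0 ab divr_gt0.
  have [mb me] : m <= b - a /\ m <= e0 / 2 by rewrite !ge_min !lexx orbT.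
  exists (a + m); split; first by apply/andP; split; lra.
  by exists [::]; apply: h0; apply/andP; split; lra.
have sE : has_sup E by split; [exists t0 | exists b].
have aT : a < sup E.
  by case: (E0) => /andP[at0 _] _; apply: lt_le_trans at0 _;
    apply: ub_le_sup (sE.2) _ E0.
have Tb : sup E <= b by apply: ge_sup => //; exists t0.
have [s Ts] : exists s, jumps_sum a (sup E) s.
  have [e e_gt0 he] := jumps_sum_left aT.
  have [t Et te] := sup_adherent e_gt0 sE.
  have := ub_le_sup sE.2 Et; rewrite le_eqVlt => /predU1P[<-|tT].
    by case: Et.
  by case: Et => /andP[a_t _] [s ts]; exists s; apply: he ts; rewrite ?te.
move: Tb; rewrite le_eqVlt => /predU1P[<-|Tb]; first by exists s.
have [e e_gt0 he] := jumps_sum_right aT Ts.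
pose m := Num.min (b - sup E) (e / 2).
have m0 : 0 < m by rewrite lt_min subr_gt0 Tb divr_gt0.
have [mb me] : m <= b - sup E /\ m <= e / 2 by rewrite !ge_min !lexx orbT.
suff /(ub_le_sup sE.2) : E (sup E + m) by lra.
split; first by apply/andP; split; lra.
by exists (sup E :: s); apply: he; apply/andP; split; lra.
Qed.

(** * Jensen formula: the weight of a point *)

(** Signed contribution of [z] in all orders: roots count positively, poles negatively. *)
Definition jensen_weight (r z : R) : R :=
  \sum_(1 <= j < n.+1) omega g j z * (r - `|z|) ^+ j.

(** By continuity both germs at [x] have the constant term [g x], which cancels in jumps. *)
Lemma horner_germ_taylor (b : bool) (x h : R) :
  (G b x).[x + h] = g x + \sum_(1 <= j < n.+1) (G b x)^`N(j).[x] * h ^+ j.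
Proof.
have [sp gx _] := gG b x.
rewrite (@nderiv_taylor_wide _ n.+1) //; last exact: mulrC.
rewrite -(big_mkord xpredT (fun i => (G b x)^`N(i).[x] * h ^+ i)).
by rewrite big_nat_recl // nderivn0 expr0 mulr1 -gx big_add1.
Qed.

(** All signs are 1, so [omega g j z] is a Taylor coefficient of the jump, and the step from [z] to
    [r] is [r - |z|]. *)
Lemma jensen_weight_gt0 (r z : R) : 0 < z ->
  jensen_weight r z = (G true z - G false z).[r].
Proof.
move=> z0; have -> : (G true z - G false z).[r] =
    (G true z - G false z).[z + (r - z)] by congr (_.[_]); ring.
rewrite hornerD hornerN !horner_germ_taylor opprD addrACA subrr add0r -sumrB.
rewrite /jensen_weight; apply: eq_bigr => j _.
rewrite (omega_germ j (gG true z) (gG false z)) /sgn_right /sgn_left.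
by rewrite gt_eqF // gtr0_sg // expr1n !mul1r gtr0_norm // mulrBl.
Qed.

(** The step from [z] to [- r] is minus [r - |z|]. Its power gives [(-1)^j] against [(-1)^(j+1)] in
    [omega], which leaves one minus sign. *)
Lemma jensen_weight_lt0 (r z : R) : z < 0 ->
  jensen_weight r z = - (G true z - G false z).[- r].
Proof.
move=> z0; have -> : (G true z - G false z).[- r] =
    (G true z - G false z).[z - (r + z)] by congr (_.[_]); ring.
rewrite hornerD hornerN opprB !horner_germ_taylor.
rewrite [- (g z + _)]opprD addrACA subrr add0r.
rewrite -sumrB; apply: eq_bigr => j _.
rewrite (omega_germ j (gG true z) (gG false z)) /sgn_right /sgn_left.
rewrite lt_eqF // ltr0_sg // ltr0_norm // opprK exprS mulN1r.
by rewrite [(- (r + z)) ^+ j]exprNn; ring.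
Qed.

(** The left germ enters with sign [-(-1)^(j+1) = (-1)^j], hence its evaluation at [- r]. Each germ
    has the constant term [g 0]. *)
Lemma jensen_weight0 (r : R) :
  jensen_weight r 0 = (G true 0).[r] + (G false 0).[- r] - 2 * g 0.
Proof.
have cancel0 (a b c : R) : c + a + (c + b) - 2 * c = a + b by ring.
rewrite -[in (G true 0).[_]](add0r r) -[- r]add0r !horner_germ_taylor cancel0.
rewrite -big_split /=.
apply: eq_bigr => j _.
rewrite (omega_germ j (gG true 0) (gG false 0)) /sgn_right /sgn_left eqxx.
by rewrite expr1n mul1r normr0 subr0 [(- r) ^+ j]exprNn exprS; ring.
Qed.

(* The germs at [r] and [- r] are reached from those at [0] by adding jumps,
   and Taylor's formula at [z] identifies the value of a jump at [r] with
   the weight of [z]; the constant terms cancel by continuity of [g]. *)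
Lemma jensen_weights (r : R) : 0 < r -> exists s : seq R,
  [/\ uniq s, forall z, z \in s -> - r < z < r,
      g r + g (- r) - 2 * g 0 = \sum_(z <- s) jensen_weight r z &
      forall z j, - r < z < r -> z \notin s -> omega g j z = 0].
Proof.
move=> r0; have nr0 : - r < 0 by rewrite oppr_lt0.
have [s1 [u1 b1 e1 n1]] := exists_jumps_sum r0.
have [s2 [u2 b2 e2 n2]] := exists_jumps_sum nr0.
have z1 : 0 \notin s1 by apply/negP => /b1; rewrite ltxx.
have z2 : 0 \notin s2 by apply/negP => /b2; rewrite ltxx andbF.
exists (0 :: s1 ++ s2); split.
- rewrite /= mem_cat negb_or z1 z2 cat_uniq u1 u2 !andbT /=.
  by apply/hasPn => z /b2 zb; apply/negP => /b1; lra.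
- move=> z; rewrite in_cons mem_cat => /or3P[/eqP ->|/b1|/b2]; lra.
- rewrite big_cons big_cat /= jensen_weight0.
  have -> : \sum_(z <- s1) jensen_weight r z = g r - (G true 0).[r].
    have [_ -> _] := gG false r; rewrite e1 hornerD addrC addKr horner_sum.
    rewrite !big_seq; apply: eq_bigr => z /b1/andP[z0 _].
    exact: jensen_weight_gt0.
  have -> : \sum_(z <- s2) jensen_weight r z = g (- r) - (G false 0).[- r].
    (* [e2] leads from [- r] up to 0, so the germ at [- r] is the one at 0 minus the jumps. *)
    have [_ -> _] := gG true (- r); rewrite e2 hornerD opprD addNKr horner_sum.
    rewrite -sumrN !big_seq; apply: eq_bigr => z /b2/andP[_ z0].
    exact: jensen_weight_lt0.
  by ring.
- move=> z j zr; rewrite in_cons mem_cat !negb_or => /and3P[z0 zs1 zs2].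
  rewrite (omega_germ j (gG true z) (gG false z)) /sgn_right /sgn_left.
  rewrite (negPf z0).
  suff -> : G true z = G false z by rewrite subrr.
  by case: (ltgtP z 0) z0 => // ? _; [apply: n2|apply: n1] => //; lra.
Qed.

Lemma omega_oppE (j : nat) (x : R) : omega (\- g) j x = - omega g j x.
Proof.
rewrite (omega_germ j (poly_germN (gG true x)) (poly_germN (gG false x))).
rewrite (omega_germ j (gG true x) (gG false x)) !linearN !hornerN /=.
by ring.
Qed.

(** Poles of [\- g] are roots of [g] with the same multiplicity, so the difference sums [omega] with
    its sign. *)
Lemma jensen_formula (r : R) : 0 < r ->
  \sum_(1 <= j < n.+1) counting_N j r (\- g)
  - \sum_(1 <= j < n.+1) counting_N j r g
  = 2^-1 * (g r + g (- r)) - g 0.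
Proof.
move=> r0; have [s [us sr es ns]] := jensen_weights r0.
(* All poles in the interval lie in [s], so the sum over the set of poles becomes one over [s]. *)
have cE (h : R -> R) (j : nat) :
    (forall z, - r < z < r -> z \notin s -> omega h j z = 0) ->
    counting_N j r h = 2^-1 * \sum_(z <- s)
      (if omega h j z < 0 then `|omega h j z| * (r - `|z|) ^+ j else 0).
  move=> h0; rewrite /counting_N; congr (_ * _).
  rewrite -big_mkcond /= -[RHS]big_filter [RHS]fsbig_seq ?filter_uniq //.
  apply: eq_fsbigl; apply/seteqP; split=> z /=.
    rewrite /trop_pole mem_filter => -[zr zp]; rewrite zp /=.
    by apply: contraT => /(h0 _ zr) z0; rewrite z0 ltxx in zp.
  by rewrite mem_filter => /andP[zp /sr].
transitivity (2^-1 * \sum_(z <- s) jensen_weight r z);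
  last by rewrite -es; field.
rewrite exchange_big /= -sumrB big_distrr /=; apply: eq_bigr => j _.
rewrite !cE; last 2 first.
- by move=> z zr zs; exact: ns.
- by move=> z zr zs; rewrite omega_oppE ns // oppr0.
rewrite -mulrBr -sumrB; congr (_ * _); apply: eq_bigr => z _.
rewrite omega_oppE oppr_lt0 normrN; case: (ltgtP (omega g j z) 0) => w.
- by rewrite ltr0_norm //; ring.
- by rewrite gtr0_norm //; ring.
- by rewrite w; ring.
Qed.

End Jensen.

(** * From breakpoint sequences to germs *)

(** A bounded sequence would accumulate at its supremum, which strict growth keeps it from
    attaining. *)
Lemma unbounded_above_of_no_limit_point (R : realType) (b : int -> R) (x : R) :
  {homo b : k l / k < l} -> limit_point (range b) = set0 -> exists k, x < b k.
Proof.
move=> bm bl; apply: contrapT => /forallNP bx.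
have bub : ubound (range b) x by move=> _ [k _ <-]; rewrite leNgt; apply/negP.
have sb : has_sup (range b) by split; [exists (b 0); exists 0 | exists x].
suff : set0 (sup (range b)) by [].
rewrite -bl => U /nbhs_ballP[e /= e0 eU].
have [_ [k _ <-] ke] := sup_adherent e0 sb.
have bk : b k < sup (range b).
  apply: (@lt_le_trans _ _ (b (k + 1))); first by apply: bm; rewrite ltrDl.
  by apply: ub_le_sup sb.2 _ _; exists (k + 1).
exists (b k); split; [by rewrite lt_eqF | by exists k |].
by apply: eU; rewrite /ball /= gtr0_norm ?subr_gt0 //; lra.
Qed.

Lemma unbounded_below_of_no_limit_point (R : realType) (b : int -> R) (x : R) :
  {homo b : k l / k < l} -> limit_point (range b) = set0 -> exists k, b k < x.
Proof.
move=> bm bl.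
have [k xk] : exists k, - x < - b (- k).
  apply: (unbounded_above_of_no_limit_point (b := fun k => - b (- k))).
    by move=> k l kl; rewrite ltrN2; apply: bm; rewrite ltrN2.
  apply/seteqP; split=> // y yl; suff : set0 (- y) by [].
  rewrite -bl => U /(@opp_continuous R y) /yl [z [zy [k _ kz] Uz]].
  rewrite -{z}kz in zy Uz.
  exists (b (- k)); split.
  - by apply: contraNneq zy => ->; rewrite opprK.
  - by exists (- k).
  - by rewrite -[b _]opprK.
by exists (- k); rewrite -ltrN2.
Qed.

Lemma exists_segment (R : realType) (b : int -> R) (x : R) :
  {homo b : k l / k < l} -> limit_point (range b) = set0 ->
  exists k, b k <= x < b (k + 1).
Proof.
move=> bm bl; have [k0 k0x] := unbounded_below_of_no_limit_point x bm bl.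
have [k1 k1x] := unbounded_above_of_no_limit_point x bm bl.
have k01 : k0 < k1.
  rewrite ltNge le_eqVlt; apply/negP => /predU1P[k10|/bm].
    by move: k0x; rewrite -k10; lra.
  by lra.
have ex : exists i : nat, x < b (k0 + i%:Z).
  by exists `|k1 - k0|%N; rewrite gez0_abs ?subr_ge0 ?ltW // subrKC.
(* The least index is not 0 because [b k0 < x]; its predecessor starts the segment. *)
case: (ex_minnP ex) => -[|i] xi mi; first by move: xi; rewrite addr0; lra.
exists (k0 + i%:Z); rewrite -addrA [i%:Z + 1]addrC -intS xi andbT leNgt.
by apply/negP => /mi; rewrite ltnn.
Qed.

Lemma trop_meromorphic_piecewise_poly (R : realType) (k n : nat) (g : R -> R) :
  (k <= n)%N -> trop_meromorphic k g -> piecewise_poly n g.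
Proof.
case: k => [_ [c gc]|k kn [_ [b [p [bm bl gp sp _]]]]].
  by rewrite (_ : g = fun=> c); [exact: piecewise_poly_cst | exact/funext].
have size_p l : (size (p l) <= n.+1)%N.
  by have := leq_trans (sp l) kn; case: size.
move=> [] x; have [l /andP[lx xl]] := exists_segment x bm bl.
  exists (p l); split=> //; first by apply: gp; rewrite lx ltW.
  apply/near_at_sideP; exists (b (l + 1) - x) => [|y]; rewrite ?subr_gt0 //.
  by rewrite mul1r => ?; apply: gp; lra.
(* If [x] is a breakpoint, its left germ comes from the preceding segment. *)
have [l' /andP[lx' xl']] : exists l', b l' < x <= b (l' + 1).
  move: lx; rewrite le_eqVlt => /predU1P[<-|lx]; last first.
    by exists l; rewrite lx ltW.
  by exists (l - 1); rewrite subrK lexx andbT; apply: bm; rewrite ltrBlDr ltrDl.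
exists (p l'); split=> //; first by apply: gp; rewrite ltW.
apply/near_at_sideP; exists (x - b l') => [|y]; rewrite ?subr_gt0 //.
by rewrite mulN1r => ?; apply: gp; lra.
Qed.

(** * Piecewise polynomiality of [P o f] *)

(** Coefficients and empty maxima may be [-oo]; a term is then [-oo] everywhere or real
    everywhere. *)
Definition epiecewise_poly (R : realType) (n : nat) (h : R -> \bar R) : Prop :=
  h = cst -oo%E \/ exists2 g, piecewise_poly n g & h = EFin \o g.

Lemma epiecewise_polyD (R : realType) (n : nat) (h k : R -> \bar R) :
  epiecewise_poly n h -> epiecewise_poly n k ->
  epiecewise_poly n (fun x => h x + k x)%E.
Proof.
move=> [->|[g gP ->]] [->|[l lP ->]]; [by left; apply/funext..|].
by right; exists (fun x => g x + l x); [exact: piecewise_polyD|].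
Qed.

Lemma epiecewise_poly_max (R : realType) (n : nat) (h k : R -> \bar R) :
  epiecewise_poly n h -> epiecewise_poly n k ->
  epiecewise_poly n (fun x => maxe (h x) (k x)).
Proof.
move=> [->|[g gP ->]] [->|[l lP ->]].
- by left; apply/funext => x /=; rewrite maxxx.
- by right; exists l => //; apply/funext => x /=; rewrite maxNye.
- by right; exists g => //; apply/funext => x /=; rewrite maxeNy.
- right; exists (fun x => Num.max (g x) (l x)); first exact: piecewise_poly_max.
  by apply/funext => x /=; rewrite EFin_max.
Qed.

Lemma epiecewise_poly_bigmax (R : realType) (n : nat) (I : Type) (s : seq I)
    (Q : pred I) (h : I -> R -> \bar R) :
  (forall i, Q i -> epiecewise_poly n (h i)) ->
  epiecewise_poly n (fun x => \big[maxe/-oo%E]_(i <- s | Q i) h i x).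
Proof.
move=> hP; elim: s => [|i s IH].
  by left; apply/funext => x; rewrite big_nil.
case Qi: (Q i); under eq_fun do rewrite big_cons Qi; last exact: IH.
exact: epiecewise_poly_max (hP i Qi) IH.
Qed.

Lemma epiecewise_poly_sum (R : realType) (n : nat) (I : Type) (s : seq I)
    (h : I -> R -> \bar R) :
  (forall i, epiecewise_poly n (h i)) ->
  epiecewise_poly n (fun x => \sum_(i <- s) h i x)%E.
Proof.
move=> hP; elim: s => [|i s IH].
  under eq_fun do rewrite big_nil.
  by right; exists (fun=> 0); first exact: piecewise_poly_cst.
by under eq_fun do rewrite big_cons; apply: epiecewise_polyD.
Qed.

Lemma epiecewise_poly_natmul (R : realType) (n : nat) (h : R -> \bar R)
    (i : nat) : epiecewise_poly n h -> epiecewise_poly n (fun x => h x *+ i)%E.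
Proof.
(* [h x *+ 1] is [h x] itself, not [h x + 0], hence the two base cases. *)
move=> hP; elim: i => [|[|i] IH].
- by right; exists (fun=> 0); first exact: piecewise_poly_cst.
- exact: hP.
- exact: epiecewise_polyD hP IH.
Qed.

Lemma epiecewise_poly_cst (R : realType) (n : nat) (a : \bar R) :
  in_Rmax a -> epiecewise_poly n (fun=> a).
Proof.
case: a => [a _||_] //; last by left.
by right; exists (fun=> a); first exact: piecewise_poly_cst.
Qed.

Lemma trop_comp_piecewise_poly (R : realType) (n m d : nat)
    (alpha : 'I_m.+1 -> R) (beta : {ffun 'I_m.+1 -> 'I_d.+1} -> \bar R)
    (fs : 'I_m.+1 -> R -> R) :
  (forall k, piecewise_poly n (fs k)) ->
  (forall i, mixed_index i -> in_Rmax (beta i)) ->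
  piecewise_poly n (trop_comp alpha beta fs).
Proof.
move=> fP bP.
have fE k i : epiecewise_poly n (fun x => (fs k x)%:E *+ i)%E.
  by apply: epiecewise_poly_natmul; right; exists (fs k).
suff : epiecewise_poly n
    (fun x => trop_hom_poly alpha beta (fun k => (fs k x)%:E)).
  rewrite /trop_comp => -[/funeqP E|[g gP /funeqP E]].
    (* [fine] sends [-oo] to 0, which gives a constant function. *)
    by under eq_fun do rewrite E; exact: piecewise_poly_cst.
  by under eq_fun do rewrite E.
apply: epiecewise_poly_max; apply: epiecewise_poly_bigmax.
  by move=> k _; apply: epiecewise_polyD => //; exact: epiecewise_poly_cst.
move=> i /bP bi; apply: epiecewise_polyD; first exact: epiecewise_poly_cst.
by apply: epiecewise_poly_sum.
Qed.

(** * Comparison of [P] with [d] times the maximum *)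

(** Exponents of sum [d] bound each monomial from above; the pure powers give the lower bound. *)
Lemma trop_hom_poly_bound (R : realType) (m d : nat)
    (alpha : 'I_m.+1 -> R) (beta : {ffun 'I_m.+1 -> 'I_d.+1} -> \bar R) :
  (0 < d)%N -> (forall i, mixed_index i -> in_Rmax (beta i)) ->
  exists K : R, forall v : 'I_m.+1 -> R,
    `|fine (trop_hom_poly alpha beta (fun k => (v k)%:E))
      - d%:R * \big[Num.max/v ord0]_(k < m.+1) v k| <= K.
Proof.
move=> d0 bP.
(* [K] dominates every finite coefficient in absolute value; [fine] counts [-oo] as 0. *)
pose K : R := \sum_k `|alpha k| + \sum_i `|fine (beta i)|.
have aK k : `|alpha k| <= K.
  rewrite /K (bigD1 k) //= -addrA lerDl.
  by rewrite addr_ge0 ?sumr_ge0.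
have bK i : `|fine (beta i)| <= K.
  rewrite /K addrC (bigD1 i) //= -addrA lerDl.
  by rewrite addr_ge0 ?sumr_ge0.
have vE (x : R) i : (x%:E *+ i)%E = (x *+ i)%:E by rewrite EFin_natmul.
exists K => v; set M := \big[_/_]_(_ < _) _; set h := trop_hom_poly _ _ _.
have vM k : v k <= M by exact: le_bigmax.
have hM : (h <= (d%:R * M + K)%:E)%E.
  rewrite /h /trop_hom_poly ge_max; apply/andP; split.
    apply: bigmax_le => [|k _]; first by rewrite leNye.
    rewrite vE -EFinD lee_fin addrC lerD //.
      by rewrite mulr_natl lerMn2r vM orbT.
    by rewrite (le_trans (ler_norm _)).
  apply: bigmax_le => [|i iP]; first by rewrite leNye.
  under eq_bigr do rewrite vE.
  rewrite sumEFin; have := bP i iP.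
  case E: (beta i) => [r||] // _; last exact: leNye.
  rewrite -EFinD lee_fin addrC lerD //; last first.
    by rewrite (le_trans (ler_norm _)) // -[r]/(fine r%:E) -E.
  have -> : d%:R = \sum_k (i k)%:R :> R.
    by case/andP: iP => /eqP + _; rewrite -natr_sum => ->.
  rewrite mulr_suml; apply: ler_sum => k _.
  by rewrite mulr_natl lerMn2r vM orbT.
have hv k : ((d%:R * v k - K)%:E <= h)%E.
  rewrite /h /trop_hom_poly le_max; apply/orP; left.
  apply: le_trans (le_bigmax _ _ k); rewrite vE -EFinD lee_fin mulr_natl addrC.
  by rewrite lerD2r lerNl (le_trans _ (aK k)) // -normrN ler_norm.
have : (h \is a fin_num).
  rewrite fin_numE; apply/andP; split; apply/eqP => hE.
    by have := hv ord0; rewrite hE.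
  by move: hM; rewrite hE.
move: (h) hM hv => [r||] // rM rv _ /=; rewrite !lee_fin in rM.
rewrite ler_norml; apply/andP; split; last by lra.
(* A bound on every [v k] bounds their maximum without choosing a maximizing index. *)
have dM : M <= (r + K) / d%:R.
  apply: bigmax_le => [|k _]; rewrite ler_pdivlMr ?ltr0n //.
    by have := rv ord0; rewrite lee_fin; lra.
  by have := rv k; rewrite lee_fin; lra.
by move: dM; rewrite ler_pdivlMr ?ltr0n //; lra.
Qed.

(** * From the Jensen formula to the Cartan characteristic *)

Theorem theorem5p6 (R : realType) (n m d : nat)
    (f : R -> trop_proj R m) (fs : 'I_m.+1 -> R -> R)
    (alpha : 'I_m.+1 -> R) (beta : {ffun 'I_m.+1 -> 'I_d.+1} -> \bar R) :
  (0 < n)%N -> (0 < m)%N -> (0 < d)%N ->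
  trop_holomorphic_curve n f fs ->
  ~ (exists c : trop_proj R m, forall x : R, f x = c) ->
  reduced_rep fs ->
  (forall i, mixed_index i -> in_Rmax (beta i)) ->
  let Pf := trop_comp alpha beta fs in
  exists C : R, \forall r \near +oo,
    `|cartan_char fs r
      - d%:R^-1 * (\sum_(1 <= j < n.+1) counting_N j r (\- Pf)
                   - \sum_(1 <= j < n.+1) counting_N j r Pf)| <= C.
Proof.
move=> _ _ d0 [_ [deg [fs_entire deg_max]]] _ _ bP Pf.
have fsP k : piecewise_poly n (fs k).
  apply: trop_meromorphic_piecewise_poly (fs_entire k).1.
  by rewrite -deg_max leq_bigmax.
have PfP := trop_comp_piecewise_poly alpha fsP bP.
have PP b := projT2 (boolp.choice (PfP b)).
have [K PfK] := trop_hom_poly_bound alpha d0 bP.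
have d_gt0 : 0 < d%:R :> R by rewrite ltr0n.
(* The deviation of [P o f] from [d F] has weight 1 at 0 and 1/2 at each of [r] and [- r], which
   makes [2 * K]. *)
exists (d%:R^-1 * (2 * K)); near=> r.
have r0 : 0 < r by near: r; exact: nbhs_pinfty_gt.
rewrite (jensen_formula PP) // /cartan_char.
set F := fun x => \big[Num.max/fs ord0 x]_(i < m.+1) fs i x.
have {}PfK x : `|Pf x - d%:R * F x| <= K by exact: PfK.
have -> : 2^-1 * (F r + F (- r)) - F 0
    - d%:R^-1 * (2^-1 * (Pf r + Pf (- r)) - Pf 0)
  = d%:R^-1 * ((Pf 0 - d%:R * F 0) - 2^-1 * ((Pf r - d%:R * F r)
      + (Pf (- r) - d%:R * F (- r)))).
  by field; rewrite gt_eqF.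
rewrite normrM gtr0_norm ?invr_gt0 // ler_pM2l ?invr_gt0 //.
move: (PfK 0) (PfK r) (PfK (- r)); rewrite !ler_norml.
by move=> /andP[? ?] /andP[? ?] /andP[? ?]; apply/andP; split; lra.
Unshelve. all: by end_near. Qed.
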